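(* Let $A$ be a curled algebra of dimension $2$ over $\mathbb F_2$. Then: (i) $A$ is unital if and only if it is isomorphic to one of $C_{12}, C_{12'}, C_{12''}$. (ii) $A$ is commutative if and only if it is isomorphic to one of $C_0, C_1, C_{1'}, C_{1''}, C_{12}, C_{12'}, C_{12''}, C_{13}$. (iii) $A$ is associative if and only if it is isomorphic to one of $C_0, C_4, C_7, C_{10}, C_{11}, C_{12}, C_{12'}, C_{12''}, C_{14}, C_{15}$.
   Context: An algebra over the two-element field $\mathbb F_2$ is an $\mathbb F_2$-vector space with a bilinear multiplication, not assumed associative, commutative or unital; unital means having a two-sided identity element. A two-dimensional algebra is curled if, for every element $x$, the square $x^2$ is a scalar multiple of $x$. For $a,b,c,d,\varepsilon,\delta\in\mathbb F_2$, $C(a,b,c,d;\varepsilon,\delta)$ denotes the two-dimensional algebra over $\mathbb F_2$ with linear base $\{e,f\}$ and $e^2=\varepsilon e$, $f^2=\delta f$, $ef=ae+bf$, $fe=ce+df$. Put $C_0=C(0,0,0,0;0,0)$, $C_1=C(0,1,0,1;0,0)$, $C_{1'}=C(1,0,1,0;0,0)$, $C_{1''}=C(1,1,1,1;0,0)$, $C_4=C(0,1,0,0;1,0)$, $C_7=C(0,0,0,1;1,0)$, $C_{10}=C(0,0,1,0;0,1)$, $C_{11}=C(1,0,0,0;0,1)$, $C_{12}=C(0,0,0,0;1,1)$, $C_{12'}=C(0,1,0,1;1,1)$, $C_{12''}=C(1,0,1,0;1,1)$, $C_{13}=C(1,1,1,1;1,1)$, $C_{14}=C(0,1,1,0;1,1)$,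 $C_{15}=C(1,0,0,1;1,1)$. *)

(* Defs.v *)
From HB Require Import structures.
From mathcomp Require Import all_boot all_order all_algebra.
From mathcomp Require Import ring.
Set Implicit Arguments.
Unset Strict Implicit.
Unset Printing Implicit Defensive.
Import GRing.Theory.
Local Open Scope ring_scope.

(* An algebra, not assumed associative, commutative or unital, is represented
   by its underlying space together with its bilinear multiplication m. *)

Section AlgebraNotions.
Variables (K : comNzRingType) (V W : lmodType K).

Definition curled (m : {bilinear V -> V -> V}) : Prop :=
  forall x : V, exists k : K, m x x = k *: x.

Definition unital (m : {bilinear V -> V -> V}) : Prop :=
  exists u : V, left_id u m /\ right_id u m.

Definition alg_isomorphic (m : {bilinear V -> V -> V})
    (m' : {bilinear W -> W -> W}) : Prop :=
  exists phi : {linear V -> W},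
    bijective phi /\ {morph phi : x y / m x y >-> m' x y}.

End AlgebraNotions.

Definition base_e : 'rV['F_2]_2 := delta_mx 0 0.
Definition base_f : 'rV['F_2]_2 := delta_mx 0 1.

Section CAlgebra.
Variables a b c d eps del : 'F_2.

(* The bilinear extension of the multiplication table of the base {e, f},
   recorded in the lemmas C_ee, C_ff, C_ef and C_fe below. *)
Definition C_mul (x y : 'rV['F_2]_2) : 'rV['F_2]_2 :=
  (x 0 0 * y 0 0) *: (eps *: base_e)
  + (x 0 0 * y 0 1) *: (a *: base_e + b *: base_f)
  + (x 0 1 * y 0 0) *: (c *: base_e + d *: base_f)
  + (x 0 1 * y 0 1) *: (del *: base_f).

Fact C_mul_bilinear : bilinear_for *:%R *:%R C_mul.
Proof.
split=> z k x y; apply/rowP => j; rewrite /C_mul !mxE;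
  move: (_%:R) (_%:R) => u v; ring.
Qed.

HB.instance Definition _ :=
  bilinear_isBilinear.Build 'F_2 'rV['F_2]_2 'rV['F_2]_2 'rV['F_2]_2 _ _
    C_mul C_mul_bilinear.

Definition C : {bilinear 'rV['F_2]_2 -> 'rV['F_2]_2 -> 'rV['F_2]_2} := C_mul.

Lemma C_ee : C base_e base_e = eps *: base_e.
Proof.
by rewrite /C /= /C_mul !mxE /= !(mul0r, mulr0, mul1r, scale0r, scale1r, addr0).
Qed.

Lemma C_ff : C base_f base_f = del *: base_f.
Proof.
by rewrite /C /= /C_mul !mxE /= !(mul0r, mulr0, mul1r, scale0r, scale1r, add0r).
Qed.

Lemma C_ef : C base_e base_f = a *: base_e + b *: base_f.
Proof.
by rewrite /C /= /C_mul !mxE /=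
  !(mul0r, mulr0, mul1r, scale0r, scale1r, add0r, addr0).
Qed.

Lemma C_fe : C base_f base_e = c *: base_e + d *: base_f.
Proof.
by rewrite /C /= /C_mul !mxE /=
  !(mul0r, mulr0, mul1r, scale0r, scale1r, add0r, addr0).
Qed.

End CAlgebra.

Definition C0   := C 0 0 0 0 0 0.
Definition C1   := C 0 1 0 1 0 0.
Definition C1'  := C 1 0 1 0 0 0.
Definition C1'' := C 1 1 1 1 0 0.
Definition C4   := C 0 1 0 0 1 0.
Definition C7   := C 0 0 0 1 1 0.
Definition C10  := C 0 0 1 0 0 1.
Definition C11  := C 1 0 0 0 0 1.
Definition C12  := C 0 0 0 0 1 1.
Definition C12'  := C 0 1 0 1 1 1.
Definition C12'' := C 1 0 1 0 1 1.
Definition C13  := C 1 1 1 1 1 1.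
Definition C14  := C 0 1 1 0 1 1.
Definition C15  := C 1 0 0 1 1 1.

(* Main.v *)
Require Import Defs.
From mathcomp Require Import all_boot all_order all_algebra.
From HB Require Import structures.
From mathcomp Require Import ring.
Import GRing.Theory.
Local Open Scope ring_scope.

(** Choose a base {e, f} of the algebra. Curledness says that e^2 and f^2 are
    multiples of e and f, so the algebra is isomorphic to some
    C(a, b, c, d; eps, del) (curled_isomorphic_C); applied to the third nonzero
    vector e + f it gives one more equation between the structure constants,
    eps + a + c = del + b + d (C_curled_balance). This equation characterises
    the curled algebras among the C(a, b, c, d; eps, del).

    Since being unital, commutative or associative is invariant under
    isomorphism, it remains to decide which of these constants give such an
    algebra. The lists of the theorem are redundant up to isomorphism, and this
    makes the classification literal: the constants of a curled algebra with one
    of the three properties are exactly those of a member of the list, without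
    any further change of base.

    - Unital: the identity is one of the three nonzero vectors e, f, e + f, and
      each choice forces all the constants (C_unital_cases).
    - Commutative: a = c and b = d, so the extra equation becomes eps = del in
      characteristic 2, and the three free constants give eight algebras
      (C_commutative_cases).
    - Associative: left and right multiplications by a square-zero base vector
      square to zero, which removes the coefficients named in
      C_associative_eqs; the few remaining constants are then enumerated
      (C_associative_cases).

    For the converse implications, the associative algebras in the list are of
    two kinds. In C0, C4, C10 and C14 the product is x y = l(x) y for a linear
    form l, in C7, C11 and C15 it is x y = l(y) x, and both are associative
    because l is homogeneous. In C12, C12' and C12'' two linear forms identify
    the algebra with F_2 x F_2, which makes them unital as well. *)

(** * Invariance under isomorphism *)

Section Transport.
Context {K : comNzRingType} {V W : lmodType K}.
Context {m : {bilinear V -> V -> V}} {m' : {bilinear W -> W -> W}}.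

Lemma alg_isomorphic_unital : alg_isomorphic m m' -> unital m -> unital m'.
Proof.
move=> [phi [[psi _ psiK] phiM]] [u [mul1 mulu1]]; exists (phi u).
by split=> y; rewrite -(psiK y) -phiM ?mul1 ?mulu1.
Qed.

Lemma alg_isomorphic_commutative :
  alg_isomorphic m m' -> commutative m -> commutative m'.
Proof.
move=> [phi [[psi _ psiK] phiM]] mC x y.
by rewrite -(psiK x) -(psiK y) -!phiM mC.
Qed.

Lemma alg_isomorphic_associative :
  alg_isomorphic m m' -> associative m -> associative m'.
Proof.
move=> [phi [[psi _ psiK] phiM]] mA x y z.
by rewrite -(psiK x) -(psiK y) -(psiK z) -!phiM mA.
Qed.

Lemma alg_isomorphic_curled : alg_isomorphic m m' -> curled m -> curled m'.
Proof.
move=> [phi [[psi _ psiK] phiM]] mcurl x; have [k mk] := mcurl (psi x).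
by exists k; rewrite -{1 2}(psiK x) -phiM mk linearZ /= psiK.
Qed.

Lemma alg_isomorphic_sym : alg_isomorphic m m' -> alg_isomorphic m' m.
Proof.
move=> [phi [[psi phiK psiK] phiM]].
pose psiL := GRing.isLinear.Build K W V _ psi (can2_linear phiK psiK).
pose psi' : {linear W -> V} := HB.pack psi psiL.
exists psi'; split; first by exists phi.
by move=> x y /=; rewrite -{1}(psiK x) -{1}(psiK y) -phiM phiK.
Qed.

End Transport.

(** * Coordinates on the plane over F_2 *)

Lemma F2_cases (k : 'F_2) : k = 0 \/ k = 1.
Proof. by case: k => [[|[|//]] ltk]; [left | right]; apply: val_inj. Qed.

Lemma F2_11 : 1 + 1 = 0 :> 'F_2.
Proof. exact: val_inj. Qed.

(** Calculations are made on vectors in this form: the products C_vec2 can then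
    be rewritten syntactically, and vec2_inj splits an equation between vectors
    into its two coordinates. *)
Definition vec2 (p q : 'F_2) : 'rV['F_2]_2 := p *: base_e + q *: base_f.

Lemma vec2_coord p q : (vec2 p q 0 0 = p) * (vec2 p q 0 1 = q).
Proof. by rewrite /vec2 !mxE /= !(mulr0, mulr1, addr0, add0r). Qed.

Lemma vec2_inj p q r s : vec2 p q = vec2 r s -> p = r /\ q = s.
Proof.
move=> eq_v; rewrite -(vec2_coord p q).1 -{2}(vec2_coord p q).2 eq_v.
by rewrite !vec2_coord.
Qed.

Lemma vec2P (x : 'rV['F_2]_2) : exists p q, x = vec2 p q.
Proof.
exists (x 0 0), (x 0 1); apply/rowP=> j.
by case: (F2_cases j) => ->; rewrite vec2_coord.
Qed.

Lemma vec2_ind (P : 'rV['F_2]_2 -> Prop) :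
  (forall p q, P (vec2 p q)) -> forall x, P x.
Proof. by move=> Pvec x; have [p [q ->]] := vec2P x. Qed.

Lemma scale_vec2 k p q : k *: vec2 p q = vec2 (k * p) (k * q).
Proof. by rewrite /vec2 scalerDr !scalerA. Qed.

(** * Curled planes as algebras C(a, b, c, d; eps, del) *)

Section TwoDimensional.
Context {A : vectType 'F_2} {m : {bilinear A -> A -> A}}.
Variables e f : A.

Definition comb2 (x : 'rV['F_2]_2) : A := x 0 0 *: e + x 0 1 *: f.

Fact comb2_linear : linear comb2.
Proof.
move=> k x y; rewrite /comb2 !mxE !scalerDl scalerDr !scalerA.
by rewrite addrACA.
Qed.

HB.instance Definition _ :=
  GRing.isLinear.Build 'F_2 'rV['F_2]_2 A _ comb2 comb2_linear.

(** Both sides are bilinear, so the four products of base vectors decide. *)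
Lemma comb2_morph a b c d eps del :
    m e e = eps *: e -> m f f = del *: f ->
    m e f = a *: e + b *: f -> m f e = c *: e + d *: f ->
  {morph comb2 : x y / C a b c d eps del x y >-> m x y}.
Proof.
move=> ee ff ef fe x y.
have comb2_e : comb2 base_e = e.
  by rewrite /comb2 !mxE /= scale1r scale0r addr0.
have comb2_f : comb2 base_f = f.
  by rewrite /comb2 !mxE /= scale1r scale0r add0r.
rewrite /C /= /C_mul !(linearD, linearZ) /= comb2_e comb2_f.
rewrite -ee -ff -ef -fe /comb2.
rewrite (linearDl m e) (linearDl m f) /= !linearZl_LR /=.
rewrite !scalerDr !scalerA !(mulrC (y 0 _)) !addrA; congr (_ + _).
exact: addrAC.
Qed.

Hypothesis ef_basis : basis_of fullv [tuple e; f].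

Lemma comb2_bij : bijective comb2.
Proof.
pose X := [tuple e; f].
have comb2E x : comb2 x = \sum_(i < 2) x 0 i *: X`_i.
  rewrite !big_ord_recl big_ord0 addr0 /comb2 /=.
  by congr (_ + x 0 _ *: _); apply: val_inj.
exists (fun v => \row_j coord X j v) => [x | v].
  by apply/rowP=> j; rewrite mxE comb2E coord_sum_free ?(basis_free ef_basis).
rewrite {2}(coord_basis ef_basis (memvf v)) comb2E.
by apply: eq_bigr => i _; rewrite mxE.
Qed.

Lemma basis_coord2 v : exists p q, v = p *: e + q *: f.
Proof.
have [g _ gK] := comb2_bij.
by exists (g v 0 0), (g v 0 1); rewrite -{1}(gK v).
Qed.

End TwoDimensional.

Lemma curled_isomorphic_C {A : vectType 'F_2} {m : {bilinear A -> A -> A}} :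
    \dim (fullv : {vspace A}) = 2%N -> curled m ->
  exists a b c d eps del, alg_isomorphic m (C a b c d eps del).
Proof.
move=> dimA mcurl.
have [e [f ef_basis]] : exists e f : A, basis_of fullv [tuple e; f].
  case: (vbasis _) (vbasisP (fullv : {vspace A})) => s /= /eqP.
  rewrite dimA; case: s => [|e [|f [|? ?]]] //= _ ef_basis.
  by exists e, f.
have [eps ee] := mcurl e; have [del ff] := mcurl f.
have [a [b ef]] := basis_coord2 e f ef_basis (m e f).
have [c [d fe]] := basis_coord2 e f ef_basis (m f e).
exists a, b, c, d, eps, del; apply: alg_isomorphic_sym.
exists (comb2 e f); split; first exact: comb2_bij.
exact: comb2_morph.
Qed.

(** * Structure constants forced by each property *)

Section Classification.
Context {a b c d eps del : 'F_2}.
Local Notation Cm := (C a b c d eps del).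

Lemma C_vec2 p q r s : Cm (vec2 p q) (vec2 r s) =
  vec2 (p * r * eps + p * s * a + q * r * c)
       (p * s * b + q * r * d + q * s * del).
Proof.
rewrite {1}/C /= /C_mul !vec2_coord /vec2.
by apply/rowP=> j; rewrite !mxE; move: (_%:R) (_%:R) => u v; ring.
Qed.

Lemma C_commutativeP : commutative Cm <-> a = c /\ b = d.
Proof.
split=> [/(_ (vec2 1 0) (vec2 0 1)) | [ac bd] x y].
  rewrite !C_vec2 !(mulr0, mul0r, mulr1, mul1r, addr0, add0r).
  exact: vec2_inj.
elim/vec2_ind: x => p q; elim/vec2_ind: y => r s.
by rewrite !C_vec2 ac bd; congr vec2; ring.
Qed.

(** The square of e + f is (eps + a + c) e + (del + b + d) f, and a multiple of
    e + f has equal coordinates. *)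
Lemma C_curled_balance : curled Cm -> eps + a + c = del + b + d.
Proof.
move=> /(_ (vec2 1 1)) [k]; rewrite C_vec2 scale_vec2.
by move=> /vec2_inj[]; rewrite !(mulr1, mul1r) => -> <-; ring.
Qed.

Lemma C_commutative_cases : curled Cm -> commutative Cm ->
  Cm = C0 \/ Cm = C1 \/ Cm = C1' \/ Cm = C1'' \/ Cm = C12 \/
  Cm = C12' \/ Cm = C12'' \/ Cm = C13.
Proof.
move=> /C_curled_balance bal /C_commutativeP[ac bd]; move: bal.
have addKK (k l : 'F_2) : k + l + l = k.
  by rewrite -addrA; case: (F2_cases l) => ->; rewrite ?F2_11 ?addr0.
rewrite ac bd !addKK => ->.
case: (F2_cases del) => ->; case: (F2_cases c) => ->; case: (F2_cases d) => ->.
- by left.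
- by right; left.
- by do 2!right; left.
- by do 3!right; left.
- by do 4!right; left.
- by do 5!right; left.
- by do 6!right; left.
- by do 7!right.
Qed.

(** With identity e, the balance equation makes f^2 = f; with identity f, it
    makes e^2 = e; with identity e + f, the equations (e + f) e = e = e (e + f)
    and their analogues for f already determine the table. *)
Lemma C_unital_cases : curled Cm -> unital Cm ->
  Cm = C12 \/ Cm = C12' \/ Cm = C12''.
Proof.
move=> /C_curled_balance bal [u]; have [p [q ->]] := vec2P u => -[mul1 mulu1].
move: (mul1 (vec2 1 0)) (mul1 (vec2 0 1)).
move: (mulu1 (vec2 1 0)) (mulu1 (vec2 0 1)).
rewrite !C_vec2.
move=> /vec2_inj[+ +] /vec2_inj[+ +] /vec2_inj[+ +] /vec2_inj[+ +].
rewrite !(mulr0, mul0r, mulr1, mul1r, addr0, add0r).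
case: (F2_cases p) => ->; case: (F2_cases q) => ->;
  rewrite ?(mulr0, mul0r, mulr1, mul1r, addr0, add0r) //.
(* The identity is f, then e, then e + f; zero is excluded by 0 = 1. *)
- move=> a1 b0 _ del1 c1 d0 _ _; right; right.
  by move: bal; rewrite a1 b0 c1 d0 del1 !addr0 -addrA F2_11 addr0 => ->.
- move=> eps1 _ c0 d1 _ _ a0 b1; right; left.
  by move: bal; rewrite a0 b1 c0 d1 eps1 !addr0 -addrA F2_11 addr0 => <-.
- move=> + b0 c0 + _ d0 a0 _; rewrite a0 b0 c0 d0 !(addr0, add0r).
  by move=> -> ->; left.
Qed.

(** These come from five of the eight associativity conditions on base vectors.
    Over F_2 every scalar is idempotent; thus e (e f) = (e e) f, whose
    f-coordinate reads b^2 = eps b, gives b = eps b, and similarly for d, a, c.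
    The first coordinate of the same identity gives b a = 0, and the last
    equation is the e-coordinate of e (f e) = (e f) e. *)
Lemma C_associative_eqs : associative Cm ->
  [/\ b = eps * b, d = eps * d, a = del * a & c = del * c] /\
  [/\ b * a = 0 & c * eps + d * a = a * eps + b * c].
Proof.
(* The multiplication is abstracted so that rewriting does not try to compute
   it on closed vectors. *)
pose mul := fun x y => Cm x y.
have mulE p q r s : mul (vec2 p q) (vec2 r s) =
    vec2 (p * r * eps + p * s * a + q * r * c)
         (p * s * b + q * r * d + q * s * del) by exact: C_vec2.
move=> mulA; have {mulA} : associative mul by exact: mulA.
move: mul mulE => mul mulE mulA.
have ee : mul (vec2 1 0) (vec2 1 0) = vec2 eps 0.
  by rewrite mulE; congr vec2; ring.
have ef : mul (vec2 1 0) (vec2 0 1) = vec2 a b.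
  by rewrite mulE; congr vec2; ring.
have fe : mul (vec2 0 1) (vec2 1 0) = vec2 c d.
  by rewrite mulE; congr vec2; ring.
have ff : mul (vec2 0 1) (vec2 0 1) = vec2 0 del.
  by rewrite mulE; congr vec2; ring.
have := mulA (vec2 1 0) (vec2 1 0) (vec2 0 1).
have := mulA (vec2 1 0) (vec2 0 1) (vec2 0 1).
have := mulA (vec2 0 1) (vec2 0 1) (vec2 1 0).
have := mulA (vec2 0 1) (vec2 1 0) (vec2 1 0).
have := mulA (vec2 1 0) (vec2 0 1) (vec2 1 0).
rewrite ee ef fe ff !mulE.
rewrite !(mulr0, mul0r, mulr1, mul1r, addr0, add0r).
move=> /vec2_inj[mid _] /vec2_inj[_ ed].
move=> /vec2_inj[gc _] /vec2_inj[ga _] /vec2_inj[ab eb].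
have F2_idem (k : 'F_2) : k * k = k.
  by case: (F2_cases k) => ->; rewrite ?mulr0 ?mulr1.
rewrite !F2_idem in eb ed ga gc.
have ba0 : b * a = 0 by apply: (addrI (a * eps)); rewrite ab addr0 mulrC.
by do 2!split.
Qed.

Lemma C_associative_cases : curled Cm -> associative Cm ->
  Cm = C0 \/ Cm = C4 \/ Cm = C7 \/ Cm = C10 \/ Cm = C11 \/ Cm = C12 \/
  Cm = C12' \/ Cm = C12'' \/ Cm = C14 \/ Cm = C15.
Proof.
move=> /C_curled_balance bal /C_associative_eqs[[eb ed ga gc] [ab mid]].
case: (F2_cases eps) => eps_val; case: (F2_cases del) => del_val;
  move: bal mid eb ed gc ga ab; rewrite eps_val del_val;
  rewrite !(mulr0, mul0r, mulr1, mul1r, addr0, add0r).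
(* e^2 = f^2 = 0 *)
- by move=> _ _ -> -> -> -> _; left.
(* e^2 = 0 and f^2 = f: here b = d = 0 and a + c = 1 *)
- move=> bal _ b0 d0 _ _ _; move: bal; rewrite b0 d0 !addr0.
  case: (F2_cases a) => ->; first by rewrite add0r => ->; do 3!right; left.
  case: (F2_cases c) => ->; last by rewrite F2_11.
  by move=> _; do 4!right; left.
(* e^2 = e and f^2 = 0: here a = c = 0 and b + d = 1 *)
- move=> bal _ _ _ c0 a0 _; move: bal; rewrite c0 a0 !addr0.
  case: (F2_cases b) => ->; first by rewrite add0r => <-; do 2!right; left.
  case: (F2_cases d) => ->; last by rewrite F2_11.
  by move=> _; right; left.
(* e^2 = e and f^2 = f: here a + c = b + d *)
- rewrite -!addrA => /addrI bal mid _ _ _ _ ab; move: bal mid ab.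
  case: (F2_cases a) => ->.
    rewrite !(mulr0, mulr1, add0r, addr0) => -> + _.
    case: (F2_cases b) => ->; case: (F2_cases d) => ->;
      rewrite ?F2_11 ?(mul0r, mul1r, add0r, addr0) // => _.
    + by do 5!right; left.
    + by do 8!right; left.
    + by do 6!right; left.
  (* a = 1 forces b = 0, so that c + d = 1 *)
  rewrite !(mulr1, mul1r) => + + b0; rewrite b0 mul0r add0r addr0 => + cd1.
  move: cd1; case: (F2_cases c) => ->; rewrite ?add0r ?addr0.
    by move=> -> _; do 9!right.
  by rewrite F2_11 => _ <-; do 7!right; left.
Qed.

End Classification.

(** * Algebras with the required properties *)

Section Sufficiency.
Context {K : comNzRingType} {V : lmodType K} {m : {bilinear V -> V -> V}}.

Lemma left_scaling_associative (l : V -> K) :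
    (forall k x, l (k *: x) = k * l x) -> (forall x y, m x y = l x *: y) ->
  associative m.
Proof. by move=> lZ mE x y z; rewrite !mE lZ scalerA. Qed.

Lemma right_scaling_associative (l : V -> K) :
    (forall k x, l (k *: x) = k * l x) -> (forall x y, m x y = l y *: x) ->
  associative m.
Proof. by move=> lZ mE x y z; rewrite !mE lZ scalerA. Qed.

(** For linear forms on a plane over a field, this says that (l1, l2) is an
    algebra isomorphism onto K x K. Associativity and the identity are pulled
    back from K x K. *)
Definition split_by (l1 l2 : V -> K) :=
  [/\ {morph l1 : x y / m x y >-> x * y}, {morph l2 : x y / m x y >-> x * y},
      forall x y, l1 x = l1 y -> l2 x = l2 y -> x = y
    & exists u, l1 u = 1 /\ l2 u = 1].

Lemma split_associative {l1 l2} : split_by l1 l2 -> associative m.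
Proof. by case=> l1M l2M inj _ x y z; apply: inj; rewrite ?l1M ?l2M mulrA. Qed.

Lemma split_unital {l1 l2} : split_by l1 l2 -> unital m.
Proof.
case=> l1M l2M inj [u [l1u l2u]]; exists u.
by split=> x; apply: inj; rewrite ?l1M ?l2M ?l1u ?l2u ?mul1r ?mulr1.
Qed.

End Sufficiency.

(** With l(e) = s and l(f) = t, the product l(x) y has this table: e^2 = s e,
    e f = s f, f e = t e, f^2 = t f. The four values of (s, t) give C0, C4, C10
    and C14. *)
Lemma C_left_scaling_associative s t : associative (C 0 s t 0 s t).
Proof.
apply: (left_scaling_associative (fun x : 'rV_2 => x 0 0 * s + x 0 1 * t)).
  by move=> k x; rewrite !mxE mulrDr !mulrA.
elim/vec2_ind=> p p'; elim/vec2_ind=> q q'.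
by rewrite C_vec2 scale_vec2 !vec2_coord; congr vec2; ring.
Qed.

(** The opposite algebras: the nonzero values of (s, t) give C7, C11 and C15. *)
Lemma C_right_scaling_associative s t : associative (C t 0 0 s s t).
Proof.
apply: (right_scaling_associative (fun x : 'rV_2 => x 0 0 * s + x 0 1 * t)).
  by move=> k x; rewrite !mxE mulrDr !mulrA.
elim/vec2_ind=> p p'; elim/vec2_ind=> q q'.
by rewrite C_vec2 scale_vec2 !vec2_coord; congr vec2; ring.
Qed.

(** In each of the next three algebras two nonzero vectors are orthogonal
    idempotents with sum the third one, the identity: e and f in C12, f and
    e + f in C12', e and e + f in C12''. The forms are the coordinates in that
    base. *)
Lemma C12_split : split_by (m := C12) (fun x => x 0 0) (fun x => x 0 1).
Proof.
split; last by exists (vec2 1 1); rewrite !vec2_coord ?addr0 ?add0r.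
- elim/vec2_ind=> p p'; elim/vec2_ind=> q q'.
  by rewrite C_vec2 !vec2_coord; ring.
- elim/vec2_ind=> p p'; elim/vec2_ind=> q q'.
  by rewrite C_vec2 !vec2_coord; ring.
elim/vec2_ind=> p p'; elim/vec2_ind=> q q'.
by rewrite !vec2_coord => -> ->.
Qed.

Lemma C12'_split :
  split_by (m := C12') (fun x => x 0 0) (fun x => x 0 0 + x 0 1).
Proof.
split; last by exists (vec2 1 0); rewrite !vec2_coord ?addr0 ?add0r.
- elim/vec2_ind=> p p'; elim/vec2_ind=> q q'.
  by rewrite C_vec2 !vec2_coord; ring.
- elim/vec2_ind=> p p'; elim/vec2_ind=> q q'.
  by rewrite C_vec2 !vec2_coord; ring.
elim/vec2_ind=> p p'; elim/vec2_ind=> q q'.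
by rewrite !vec2_coord => -> /addrI ->.
Qed.

Lemma C12''_split :
  split_by (m := C12'') (fun x => x 0 1) (fun x => x 0 0 + x 0 1).
Proof.
split; last by exists (vec2 0 1); rewrite !vec2_coord ?addr0 ?add0r.
- elim/vec2_ind=> p p'; elim/vec2_ind=> q q'.
  by rewrite C_vec2 !vec2_coord; ring.
- elim/vec2_ind=> p p'; elim/vec2_ind=> q q'.
  by rewrite C_vec2 !vec2_coord; ring.
elim/vec2_ind=> p p'; elim/vec2_ind=> q q'.
by rewrite !vec2_coord => -> /addIr ->.
Qed.

Lemma or_map (P P' Q Q' : Prop) :
  (P -> P') -> (Q -> Q') -> P \/ Q -> P' \/ Q'.
Proof. by tauto. Qed.

Theorem proposition4 (A : vectType 'F_2) (m : {bilinear A -> A -> A})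
  (dimA : \dim (fullv : {vspace A}) = 2%N) (curledA : curled m) :
  [/\ unital m <->
        alg_isomorphic m C12 \/ alg_isomorphic m C12' \/ alg_isomorphic m C12'',
      commutative m <->
        alg_isomorphic m C0 \/ alg_isomorphic m C1 \/ alg_isomorphic m C1' \/
        alg_isomorphic m C1'' \/ alg_isomorphic m C12 \/
        alg_isomorphic m C12' \/ alg_isomorphic m C12'' \/
        alg_isomorphic m C13
    & associative m <->
        alg_isomorphic m C0 \/ alg_isomorphic m C4 \/ alg_isomorphic m C7 \/
        alg_isomorphic m C10 \/ alg_isomorphic m C11 \/
        alg_isomorphic m C12 \/ alg_isomorphic m C12' \/
        alg_isomorphic m C12'' \/ alg_isomorphic m C14 \/
        alg_isomorphic m C15].
Proof.
have [a [b [c [d [eps [del iso]]]]]] := curled_isomorphic_C dimA curledA.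
have isoE m' : C a b c d eps del = m' -> alg_isomorphic m m' by move=> <-.
have curledC := alg_isomorphic_curled iso curledA.
split; split.
- move=> /(alg_isomorphic_unital iso) mU.
  have := C_unital_cases curledC mU.
  by do 2![apply: or_map; first exact: isoE]; exact: isoE.
- have isoU (m' : {bilinear 'rV['F_2]_2 -> 'rV['F_2]_2 -> 'rV['F_2]_2}) l1 l2 :
      split_by (m := m') l1 l2 -> alg_isomorphic m m' -> unital m.
    by move=> m'S /alg_isomorphic_sym/alg_isomorphic_unital; apply;
      apply: split_unital m'S.
  by case=> [|[]]; apply: isoU; [exact: C12_split | exact: C12'_split |
    exact: C12''_split].
- move=> /(alg_isomorphic_commutative iso) mC.
  have := C_commutative_cases curledC mC.
  by do 7![apply: or_map; first exact: isoE]; exact: isoE.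
- have isoC a' b' del' : alg_isomorphic m (C a' b' a' b' del' del') ->
      commutative m.
    move=> /alg_isomorphic_sym/alg_isomorphic_commutative; apply.
    by apply/C_commutativeP.
  by do 7![case; first exact: isoC]; exact: isoC.
- move=> /(alg_isomorphic_associative iso) mA.
  have := C_associative_cases curledC mA.
  by do 9![apply: or_map; first exact: isoE]; exact: isoE.
- have isoA (m' : {bilinear 'rV['F_2]_2 -> 'rV['F_2]_2 -> 'rV['F_2]_2}) :
      associative m' -> alg_isomorphic m m' -> associative m.
    by move=> m'A /alg_isomorphic_sym/alg_isomorphic_associative; apply.
  case; first exact/isoA/C_left_scaling_associative.
  case; first exact/isoA/C_left_scaling_associative.
  case; first exact/isoA/C_right_scaling_associative.
  case; first exact/isoA/C_left_scaling_associative.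
  case; first exact/isoA/C_right_scaling_associative.
  case; first exact/isoA/(split_associative C12_split).
  case; first exact/isoA/(split_associative C12'_split).
  case; first exact/isoA/(split_associative C12''_split).
  case; first exact/isoA/C_left_scaling_associative.
  exact/isoA/C_right_scaling_associative.
Qed.
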